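(* Let $\ast$ be a contour in dimension $\ell$, let $\delta$ be its step function, let $N=N_\ast$ be the associated simple norm on $\mathrm{tame}([0,\infty)^\ell,\mathrm{vec}_K)$, and let $d_N$ be the distance on tame functors induced by $N$. For all $v$ and $w$ in $[0,\infty)^\ell_\infty$ and all positive integers $n\ge m>0$: $$d_N\bigl(K(v,-)^{\oplus n},K(w,-)^{\oplus m}\bigr)=\begin{cases}\delta(v,w)+\delta(w,v)&\text{if }n=m,\\ \delta(v,\infty)+\delta(w,v)&\text{if }n>m.\end{cases}$$
   Context: $[0,\infty)^\ell$ is the poset of $\ell$-tuples of non-negative reals with the coordinatewise order; $[0,\infty)^\ell_\infty$ is obtained by adding a global maximum $\infty$. $K$ is a field and $\mathrm{vec}_K$ is the category of finite dimensional $K$-vector spaces. For $v\in[0,\infty)^\ell$, $K(v,-)\colon[0,\infty)^\ell\to\mathrm{vec}_K$ is the functor with $K(v,x)=K$ if $v\le x$ and $0$ otherwise, with identity maps between nonzero values; $K(\infty,-):=0$. A functor $X\colon[0,\infty)^\ell\to\mathrm{vec}_K$ is tame if it is finitely presented, i.e. isomorphic to the cokernel of a natural transformation between finite direct sums of functors $K(v,-)$, $v\in[0,\infty)^\ell$. Tame functors form an Abelian category $\mathrm{tame}([0,\infty)^\ell,\mathrm{vec}_K)$. A contour in dimension $\ell$ is a function $\ast\colon[0,\infty)^\ell_\infty\times[0,\infty)\to[0,\infty)^\ell_\infty$ such that: (1) $v\le v\ast t$ for all $v,t$; (2) $v\ast s\le w\ast t$ whenever $v\le w$ and $s\le t$;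 (3) $(v\ast s)\ast t\le v\ast(s+t)$ for all $v,s,t$; (4) for all $v,w$, the set $\{t\in[0,\infty)\mid v\ast t\ge w\}$ is either empty or of the form $[a,\infty)$ with $a\in[0,\infty)$. Its step function is $\delta(v,w):=\inf\{t\in[0,\infty)\mid v\ast t\ge w\}\in[0,\infty]$ for $v,w\in[0,\infty)^\ell_\infty$ (with $\inf\emptyset=\infty$). The norm associated with $\ast$ is $N_\ast(X):=\inf\{t\in[0,\infty)\mid X(v\le v\ast t)=0\text{ for every }v\in[0,\infty)^\ell\text{ with }v\ast t<\infty\}$ for tame $X$. For a morphism $f$ of tame functors set $N(f):=N(\ker f)+N(\mathrm{coker}f)$. The induced distance is $d_N(X,Y):=\inf\sum_iN(f_i)$, the infimum over all finite zig-zags $X=W_0\xrightarrow{f_1}W_1\xleftarrow{f_2}W_2\xrightarrow{f_3}\cdots\xleftarrow{f_l}W_l=Y$ of tame functors. *)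

(* Defs.v *)
From HB Require Import structures.
From mathcomp Require Import all_boot all_order all_algebra.
From mathcomp Require Import all_classical all_reals all_analysis.

Set Implicit Arguments.
Unset Strict Implicit.
Unset Printing Implicit Defensive.

Import Order.TTheory GRing.Theory Num.Theory.

Local Open Scope ring_scope.

(* The canonical order of [n.-tupleprod T] is the coordinatewise one. *)
Definition pt (R : realType) (l : nat) := l.-tupleprod {nonneg R}.

(* [None] is the added maximum. *)
Definition ept (R : realType) (l : nat) := option (pt R l).

Definition eptoo (R : realType) (l : nat) : ept R l := None.
Arguments eptoo {R l}.

Definition ele (R : realType) (l : nat) (v w : ept R l) : bool :=
  match v, w with
  | _, None => true
  | None, Some _ => false
  | Some x, Some y => (x <= y)%O
  end.

Record contour (R : realType) (l : nat) := Contour {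
  cact :> ept R l -> {nonneg R} -> ept R l;
  contour_ge : forall v t, ele v (cact v t);
  contour_mono : forall (v w : ept R l) (s t : {nonneg R}),
    ele v w -> s <= t -> ele (cact v s) (cact w t);
  contour_add : forall (v : ept R l) (s t : {nonneg R}),
    ele (cact (cact v s) t) (cact v (s%:num + t%:num)%:nng);
  contour_closed : forall v w : ept R l,
    (forall t, ~~ ele w (cact v t)) \/
    (exists a : {nonneg R}, forall t, ele w (cact v t) <-> a <= t) }.

(* The infimum is taken in [\bar R], where [ereal_inf set0 = +oo]. *)
Definition step (R : realType) (l : nat) (c : contour R l) (v w : ept R l) :
    \bar R :=
  ereal_inf [set e : \bar R |
    exists2 t : {nonneg R}, ele w (c v t) & e = (t%:num)%:E].

Record pfun (R : realType) (l : nat) (K : fieldType) := PFun {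
  pobj :> pt R l -> vectType K;
  pmap : forall x y, (x <= y)%O -> 'Hom(pobj x, pobj y);
  pmap_id : forall x (h : (x <= x)%O), pmap h = \1%VF;
  pmap_comp : forall x y z (hxy : (x <= y)%O) (hyz : (y <= z)%O)
    (hxz : (x <= z)%O), pmap hxz = (pmap hyz \o pmap hxy)%VF }.

Record pnat (R : realType) (l : nat) (K : fieldType) (X Y : pfun R l K) :=
  PNat {
    pnat_app :> forall x, 'Hom(X x, Y x);
    pnat_natural : forall x y (h : (x <= y)%O),
      (pmap Y h \o pnat_app x = pnat_app y \o pmap X h)%VF }.

Definition piso (R : realType) (l : nat) (K : fieldType) (X Y : pfun R l K) :
    Prop :=
  exists (f : pnat X Y) (g : pnat Y X),
    forall x, (g x \o f x = \1)%VF /\ (f x \o g x = \1)%VF.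

Section Kernel.
Context (R : realType) (l : nat) (K : fieldType).
Context (X Y : pfun R l K) (f : pnat X Y).

Definition ker_obj (x : pt R l) : vectType K := subvs_of (lker (f x)).

Definition ker_incl (x : pt R l) : 'Hom(ker_obj x, X x) :=
  linfun (@vsval K (X x) (lker (f x))).

Definition ker_map (x y : pt R l) (h : (x <= y)%O) :
    'Hom(ker_obj x, ker_obj y) :=
  (linfun (vsproj (lker (f y))) \o pmap X h \o ker_incl x)%VF.

Lemma ker_map_val x y (h : (x <= y)%O) (u : ker_obj x) :
  vsval (ker_map h u) = pmap X h (vsval u).
Proof.
rewrite /ker_map !comp_lfunE !lfunE /= vsprojK // memv_ker.
have /lfunP/(_ (vsval u)) := pnat_natural f h; rewrite !comp_lfunE => <-.
by have := subvsP u; rewrite memv_ker => /eqP ->; rewrite linear0.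
Qed.

Lemma ker_map_id (x : pt R l) (h : (x <= x)%O) : ker_map h = \1%VF.
Proof.
by apply/lfunP => u; apply: val_inj; rewrite /= ker_map_val pmap_id !lfunE.
Qed.

Lemma ker_map_comp (x y z : pt R l) (hxy : (x <= y)%O) (hyz : (y <= z)%O)
  (hxz : (x <= z)%O) : ker_map hxz = (ker_map hyz \o ker_map hxy)%VF.
Proof.
apply/lfunP => u; apply: val_inj.
by rewrite /= comp_lfunE !ker_map_val (pmap_comp _ hxy hyz) comp_lfunE.
Qed.

Definition pker : pfun R l K := PFun ker_map_id ker_map_comp.

(* The cokernel at [x] is realized on the complement of the image of [f x];
   [coker_proj] is the projection onto it along the image. *)
Definition coker_obj (x : pt R l) : vectType K := subvs_of (limg (f x))^C.

Definition coker_proj (x : pt R l) : 'Hom(Y x, coker_obj x) :=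
  (linfun (vsproj (limg (f x))^C) \o daddv_pi (limg (f x))^C (limg (f x)))%VF.

Definition coker_map (x y : pt R l) (h : (x <= y)%O) :
    'Hom(coker_obj x, coker_obj y) :=
  (coker_proj y \o pmap Y h \o linfun (@vsval K (Y x) (limg (f x))^C))%VF.

Lemma coker_proj_val x (u : coker_obj x) : coker_proj x (vsval u) = u.
Proof.
rewrite /coker_proj comp_lfunE lfunE /= daddv_pi_id ?vsvalK ?subvsP //.
by rewrite capvC capv_compl.
Qed.

Lemma coker_proj_decomp x (u : Y x) :
  u - vsval (coker_proj x u) \in limg (f x).
Proof.
rewrite /coker_proj comp_lfunE lfunE /= vsprojK ?memv_pi //.
rewrite -[X in X - _](@daddv_pi_add _ _ (limg (f x))^C (limg (f x)) u).
- by rewrite addrAC subrr add0r memv_pi.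
- by rewrite capvC capv_compl.
- by rewrite addvC addv_complf memvf.
Qed.

Lemma lker_coker_proj x : lker (coker_proj x) = limg (f x).
Proof.
apply/vspaceP => u; rewrite memv_ker; apply/eqP/idP => [u0|uf].
  by have := coker_proj_decomp u; rewrite u0 /= subr0.
have wf : vsval (coker_proj x u) \in (limg (f x) :&: (limg (f x))^C)%VS.
  rewrite memv_cap subvsP andbT.
  by have := memvB uf (coker_proj_decomp u); rewrite opprB addrC subrK.
by move: wf; rewrite capv_compl memv0 => /eqP w0; apply: val_inj.
Qed.

Lemma coker_map_proj x y (h : (x <= y)%O) (u : Y x) :
  coker_map h (coker_proj x u) = coker_proj y (pmap Y h u).
Proof.
have : pmap Y h u - pmap Y h (vsval (coker_proj x u)) \in lker (coker_proj y).
  rewrite lker_coker_proj -linearB /=.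
  have /memv_imgP[z _ ->] := coker_proj_decomp u.
  have /lfunP/(_ z) := pnat_natural f h; rewrite !comp_lfunE => ->.
  by rewrite memv_img ?memvf.
rewrite memv_ker linearB subr_eq0 => /eqP ->.
by rewrite /coker_map 2!comp_lfunE [linfun vsval _]lfunE.
Qed.

Lemma coker_map_id (x : pt R l) (h : (x <= x)%O) : coker_map h = \1%VF.
Proof.
apply/lfunP => u; rewrite -[u]coker_proj_val coker_map_proj pmap_id.
by rewrite !lfunE.
Qed.

Lemma coker_map_comp (x y z : pt R l) (hxy : (x <= y)%O) (hyz : (y <= z)%O)
  (hxz : (x <= z)%O) : coker_map hxz = (coker_map hyz \o coker_map hxy)%VF.
Proof.
apply/lfunP => u; rewrite comp_lfunE -[u]coker_proj_val !coker_map_proj.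
by rewrite (pmap_comp _ hxy hyz) comp_lfunE.
Qed.

Definition pcoker : pfun R l K := PFun coker_map_id coker_map_comp.

End Kernel.

Section DirectSum.
Context (R : realType) (l : nat) (K : fieldType).

Definition pzero : pfun R l K.
Proof.
exists (fun=> 'rV[K]_0) (fun _ _ _ => \1%VF) => //.
by move=> *; rewrite comp_lfun1l.
Defined.

Section Binary.
Context (X Y : pfun R l K).

Definition sum_obj (x : pt R l) : vectType K := (X x * Y x)%type.

Definition sum_fun (x y : pt R l) (h : (x <= y)%O) (u : sum_obj x) :
    sum_obj y := (pmap X h u.1, pmap Y h u.2).

Lemma sum_fun_linear x y (h : (x <= y)%O) : linear (sum_fun h).
Proof. by move=> a u w; rewrite /sum_fun /= !linearP. Qed.

HB.instance Definition _ x y (h : (x <= y)%O) :=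
  GRing.isLinear.Build K (sum_obj x) (sum_obj y) _ (sum_fun h)
    (sum_fun_linear h).

Definition sum_map (x y : pt R l) (h : (x <= y)%O) :
    'Hom(sum_obj x, sum_obj y) := linfun (sum_fun h).

Lemma sum_map_id (x : pt R l) (h : (x <= x)%O) : sum_map h = \1%VF.
Proof.
by apply/lfunP => -[u w]; rewrite !lfunE /= /sum_fun !pmap_id !lfunE.
Qed.

Lemma sum_map_comp (x y z : pt R l) (hxy : (x <= y)%O) (hyz : (y <= z)%O)
  (hxz : (x <= z)%O) : sum_map hxz = (sum_map hyz \o sum_map hxy)%VF.
Proof.
apply/lfunP => -[u w]; rewrite comp_lfunE !lfunE /= /sum_fun /=.
by rewrite !(pmap_comp _ hxy hyz) !comp_lfunE.
Qed.

Definition psum2 : pfun R l K := PFun sum_map_id sum_map_comp.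

End Binary.

Definition psum (s : seq (pfun R l K)) : pfun R l K := foldr psum2 pzero s.

Definition ppow (X : pfun R l K) (n : nat) : pfun R l K := psum (nseq n X).

End DirectSum.

Section Free.
Context (R : realType) (l : nat) (K : fieldType) (v : ept R l).

(* The boolean [ele v (Some x)] is used as the dimension 0 or 1; in particular
   the functor is zero when [v] is the added maximum. *)
Definition free_obj (x : pt R l) : vectType K := 'rV[K]_(ele v (Some x)).

(* [pid_mx 1] is the identity matrix when both dimensions are 1. *)
Definition free_map (x y : pt R l) (h : (x <= y)%O) :
    'Hom(free_obj x, free_obj y) :=
  linfun (mulmxr (pid_mx 1 : 'M[K]_(ele v (Some x), ele v (Some y)))).

Lemma ele_trans_pt (x y : pt R l) :
  (x <= y)%O -> ele v (Some x) -> ele v (Some y).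
Proof. by case: v => //= a xy ax; apply: le_trans xy. Qed.

Lemma free_map_id (x : pt R l) (h : (x <= x)%O) : free_map h = \1%VF.
Proof.
apply/lfunP => u; rewrite !lfunE /= /mulmxr.
rewrite /free_obj in u *; case: (ele v (Some x)) u => u /=.
  by rewrite pid_mx_1 mulmx1.
by rewrite !thinmx0; apply/rowP => -[].
Qed.

Lemma free_map_comp (x y z : pt R l) (hxy : (x <= y)%O) (hyz : (y <= z)%O)
  (hxz : (x <= z)%O) : free_map hxz = (free_map hyz \o free_map hxy)%VF.
Proof.
apply/lfunP => u; rewrite comp_lfunE !lfunE /= /mulmxr -mulmxA.
congr (_ *m _); have := ele_trans_pt hxy.
case: (ele v (Some y)) => [_|]; first by rewrite pid_mx_id.
case: (ele v (Some x)) => [/(_ isT)|_] //.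
by apply/matrixP => -[].
Qed.

Definition pfree : pfun R l K := PFun free_map_id free_map_comp.

End Free.

Definition free_sum (R : realType) (l : nat) (K : fieldType)
    (s : seq (pt R l)) : pfun R l K :=
  psum [seq pfree K (Some a) | a <- s].

Definition tame (R : realType) (l : nat) (K : fieldType) (X : pfun R l K) :
    Prop :=
  exists (s t : seq (pt R l)) (g : pnat (free_sum K s) (free_sum K t)),
    piso X (pcoker g).

Section Distance.
Context (R : realType) (l : nat) (K : fieldType) (c : contour R l).

(* The defining formula makes sense without tameness. *)
Definition pnorm (X : pfun R l K) : \bar R :=
  ereal_inf [set e : \bar R | exists2 t : {nonneg R},
    (forall (v u : pt R l) (h : (v <= u)%O),
       c (Some v) t = Some u -> pmap X h = 0) & e = (t%:num)%:E].

Definition nnorm (X Y : pfun R l K) (f : pnat X Y) : \bar R :=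
  (pnorm (pker f) + pnorm (pcoker f))%E.

(* [zigzag X Y e]: some zig-zag X -> W_1 <- W_2 -> ... <- Y of tame functors
   has total norm [e]. *)
Inductive zigzag : pfun R l K -> pfun R l K -> \bar R -> Prop :=
| ZigzagOne (X W Y : pfun R l K) (f : pnat X W) (g : pnat Y W) :
    tame X -> tame W -> tame Y ->
    zigzag X Y (nnorm f + nnorm g)%E
| ZigzagCons (X W Z Y : pfun R l K) (f : pnat X W) (g : pnat Z W)
    (e : \bar R) :
    tame X -> tame W -> zigzag Z Y e ->
    zigzag X Y (nnorm f + nnorm g + e)%E.

Definition pdist (X Y : pfun R l K) : \bar R :=
  ereal_inf [set e | zigzag X Y e].

End Distance.

(* Main.v *)
(** Upper bound: for the join [z] of [v] and [w], the monomorphisms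
    [K(z,-)^m -> K(v,-)^n] and [K(z,-)^m -> K(w,-)^m] have cokernels whose norms
    are at most the two summands.

    Lower bound: along a zig-zag from [X] to [Y], an element is mapped by the
    forward maps and, at the price of the norms of their cokernels, lifted
    through the backward maps, once it has been pushed far enough. If its image
    in [Y] dies, then so does the element itself, after a delay given by the
    norms of the kernels of the forward maps. From [K(v,-)^n] to [K(w,-)^m] this
    forces [delta(v,w)] (for [n > m], by counting dimensions,
    [delta(v,infinity)]) to be at most the sum of these norms. The opposite
    direction uses exactly the remaining kernels and cokernels, so the two
    bounds add up. *)

From HB Require Import structures.
From mathcomp Require Import all_boot all_order all_algebra.
From mathcomp Require Import all_classical all_reals all_analysis.
From mathcomp Require Import lra.
Require Import Defs.

Set Implicit Arguments.
Unset Strict Implicit.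
Unset Printing Implicit Defensive.

Import Order.TTheory GRing.Theory Num.Theory.

Local Open Scope ring_scope.

(** * Finiteness and additivity for contours *)

Section Contour.
Context (R : realType) (l : nat) (c : contour R l).

Lemma ele_refl (v : ept R l) : ele v v.
Proof. by case: v => /=. Qed.

Lemma ele_trans (u v w : ept R l) : ele u v -> ele v w -> ele u w.
Proof. by case: u v w => [u|] [v|] [w|] //=; apply: le_trans. Qed.

Lemma ele_SomeP (v : ept R l) (y : pt R l) :
  ele v (Some y) -> exists2 x, v = Some x & (x <= y)%O.
Proof. by case: v => //= x; exists x. Qed.

Lemma cact_SomeW (x y : pt R l) (t : {nonneg R}) :
  c (Some x) t = Some y -> (x <= y)%O.
Proof. by move=> xy; have := contour_ge c (Some x) t; rewrite xy. Qed.

Lemma cact_add_le (v : ept R l) (s t r : {nonneg R}) :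
  s%:num + t%:num <= r%:num -> ele (c (c v s) t) (c v r).
Proof.
by move=> str; apply: ele_trans (contour_add _ _ _ _) (contour_mono _ _ _);
  first exact: ele_refl.
Qed.

Lemma step_le (v w : ept R l) (t : {nonneg R}) :
  ele w (c v t) -> (step c v w <= t%:num%:E)%E.
Proof. by move=> wt; apply: ge_ereal_inf; exists t%:num%:E => //; exists t. Qed.

End Contour.

(** * Elementary bounds on the norm *)

Section Norm.
Context (R : realType) (l : nat) (K : fieldType) (c : contour R l).
Implicit Types (X Y : pfun R l K).

Definition vanishes_within X (t : {nonneg R}) : Prop :=
  forall (v u : pt R l) (h : (v <= u)%O), c (Some v) t = Some u -> pmap X h = 0.

Lemma pnorm_ge0 X : (0 <= pnorm c X)%E.
Proof. by apply: le_ereal_inf_tmp => _ [t _ ->]; rewrite lee_fin. Qed.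

Lemma nnorm_ge0 X Y (f : pnat X Y) : (0 <= nnorm c f)%E.
Proof. by rewrite adde_ge0 // pnorm_ge0. Qed.

Lemma pnorm_le X t : vanishes_within X t -> (pnorm c X <= t%:num%:E)%E.
Proof. by move=> Xt; apply: ge_ereal_inf; exists t%:num%:E => //; exists t. Qed.

Lemma pnorm_lt X (r : R) : (pnorm c X < r%:E)%E ->
  exists2 t, vanishes_within X t & t%:num <= r.
Proof.
by move=> /ereal_inf_lt[_ [t Xt ->]]; rewrite lte_fin => /ltW; exists t.
Qed.

Lemma lte_adde_split (a b : \bar R) (r : R) :
  (0 <= a)%E -> (0 <= b)%E -> (a + b < r%:E)%E ->
  exists s t, [/\ (a < s%:E)%E, (b < t%:E)%E & s + t = r].
Proof.
case: a b => [a||] [b||] //=; rewrite !lee_fin -EFinD lte_fin => a0 b0 abr.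
(* Each summand receives half of the slack; nonnegativity has excluded infinite values. *)
exists (a + (r - a - b) / 2), (b + (r - a - b) / 2).
by rewrite !lte_fin; split; lra.
Qed.

End Norm.

(** * Transporting elements along a zig-zag *)

Section Transport.
Context (R : realType) (l : nat) (K : fieldType) (c : contour R l).
Implicit Types (X Y Z W : pfun R l K) (a b : {nonneg R}).

(* [a] bounds how much longer an element lives than its image, and [b] how far
   it has to be pushed forward before it has an image. *)
Definition transports X Y a b : Prop :=
  forall x x' : pt R l, c (Some x) b = Some x' ->
  exists (y : pt R l) (hxy : (x <= y)%O) (phi : 'Hom(X x, Y y)), (y <= x')%O /\
  forall (u : X x) (q q' : pt R l) (hyq : (y <= q)%O) (hxq' : (x <= q')%O),
    c (Some q) a = Some q' -> pmap Y hyq (phi u) = 0 -> pmap X hxq' u = 0.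

(** Delays add up because acting by [s] and then by [t] stays below acting by [s + t]; intermediate
    points are finite because they act into something below a finite point. *)
Lemma transports_comp X Y Z a1 a2 b1 b2 a b :
  a1%:num + a2%:num <= a%:num -> b1%:num + b2%:num <= b%:num ->
  transports X Y a1 b1 -> transports Y Z a2 b2 -> transports X Z a b.
Proof.
move=> a12 b12 XY YZ x x' xx'.
have := cact_add_le c (Some x) b12; rewrite xx'.
case Ex : (c (Some x) b1) => [x1|]; last first.
  by have := contour_ge c None b2; case: (c None b2).
have [y [hxy [phi [yx1 phiP]]]] := XY _ _ Ex.
move=> /(ele_trans (contour_mono c (v := Some y) (w := Some x1) yx1 (lexx b2))).
case/ele_SomeP => y1 Ey y1x'.
have [z [hyz [psi [zy1 psiP]]]] := YZ _ _ Ey.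
exists z, (le_trans hxy hyz), (psi \o phi)%VF; split; first exact: le_trans y1x'.
move=> u q q' hzq hxq' Eq; rewrite comp_lfunE => psi0.
(* Vanishing is traced backwards, so the delay [a2] of the second transport comes first. *)
have := cact_add_le c (Some q) (s := a2) (t := a1) (r := a).
rewrite addrC Eq => /(_ a12).
case Eq2 : (c (Some q) a2) => [q2|]; last first.
  by have := contour_ge c None a1; case: (c None a1).
case/ele_SomeP => q1 Eq1 q1q'.
have qq2 := cact_SomeW Eq2.
have q2q1 := cact_SomeW Eq1.
have hyq2 : (y <= q2)%O by rewrite (le_trans hyz) // (le_trans hzq).
have hxq1 : (x <= q1)%O by rewrite (le_trans hxy) // (le_trans hyq2).
rewrite (pmap_comp X hxq1 q1q') comp_lfunE.
by rewrite (phiP u q2 q1 hyq2) ?linear0 //; apply: psiP psi0.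
Qed.

(** Once the image of an element dies, the element lies in the kernel of [f], where it survives no
    action by [a]. *)
Lemma transports_fwd X Y (f : pnat X Y) a :
  vanishes_within c (pker f) a -> transports X Y a 0%:nng.
Proof.
move=> fa x x' xx'; exists x, (lexx x), (f x); split; first exact: cact_SomeW xx'.
move=> u q q' hxq hxq' Eq.
have /lfunP/(_ u) := pnat_natural f hxq; rewrite !comp_lfunE => -> fu0.
have uker : pmap X hxq u \in lker (f q) by rewrite memv_ker; apply/eqP.
have hqq' := cact_SomeW Eq.
have ker0 : ker_map f hqq' = 0 := fa _ _ hqq' Eq.
have := ker_map_val hqq' (Subvs uker).
by rewrite ker0 lfunE /= -comp_lfunE -pmap_comp => <-.
Qed.

Lemma transports_bwd X Y (g : pnat Y X) b :
  vanishes_within c (pcoker g) b -> transports X Y 0%:nng b.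
Proof.
move=> gb x x' xx'.
have hxx' := cact_SomeW xx'.
exists x', hxx', ((g x')^-1 \o pmap X hxx')%VF; split => // u q q' hxq hxq' Eq.
(* The class of [u] in the cokernel has died at [x'], so [u] pushed to [x'] lies in the image of
   [g], on which [g^-1] is a linear section. *)
have gK : g x' ((g x')^-1%VF (pmap X hxx' u)) = pmap X hxx' u.
  apply: limg_lfunVK; rewrite -lker_coker_proj memv_ker -coker_map_proj.
  have coker0 : coker_map g hxx' = 0 := gb _ _ hxx' xx'.
  by rewrite coker0 lfunE.
rewrite comp_lfunE => u0; have qq' := cact_SomeW Eq.
have /lfunP/(_ ((g x')^-1%VF (pmap X hxx' u))) := pnat_natural g hxq.
rewrite !comp_lfunE gK u0 linear0 -comp_lfunE -(pmap_comp _ _ _ (le_trans hxx' hxq)).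
by rewrite (pmap_comp _ (le_trans hxx' hxq) qq') comp_lfunE => ->; rewrite linear0.
Qed.

(* The kernels of the forward maps and the cokernels of the backward maps pay
   for one direction, the remaining ones for the other direction. *)
Definition transports_both X Y (r : R) : Prop :=
  exists a b a' b', [/\ transports X Y a b, transports Y X a' b' &
    (a%:num + b%:num) + (a'%:num + b'%:num) <= r].

Lemma transports_both_cospan X W Y (f : pnat X W) (g : pnat Y W) (r : R) :
  (nnorm c f + nnorm c g < r%:E)%E -> transports_both X Y r.
Proof.
case/lte_adde_split; rewrite ?nnorm_ge0 // => s [t [fs gt <-]].
have [||s1 [s2 [/pnorm_lt[a fa as1] /pnorm_lt[b' fb' bs2] <-]]] :=
  lte_adde_split _ _ fs; rewrite ?pnorm_ge0 //.
have [||t1 [t2 [/pnorm_lt[a' ga' at1] /pnorm_lt[b gb bt2] <-]]] :=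
  lte_adde_split _ _ gt; rewrite ?pnorm_ge0 //.
(* [a] and [b'] bound the kernel and cokernel of [f], and [a'] and [b] those of [g]. *)
exists a, b, a', b'; split; last by lra.
- by apply: transports_comp (transports_fwd fa) (transports_bwd gb);
    rewrite ?addr0 ?add0r.
- by apply: transports_comp (transports_fwd ga') (transports_bwd fb');
    rewrite ?addr0 ?add0r.
Qed.

(** Nonnegativity of [e] is carried through the induction because it allows the strict bound to be
    split between the first cospan and the rest. *)
Lemma zigzag_transports X Y (e : \bar R) : zigzag c X Y e ->
  (0 <= e)%E /\ forall r : R, (e < r%:E)%E -> transports_both X Y r.
Proof.
elim=> [{}X W {}Y f g _ _ _|{}X W Z {}Y f g e' _ _ _ [e'0 IH]].
  split; first by rewrite adde_ge0 // nnorm_ge0.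
  by move=> r; apply: transports_both_cospan.
have fg0 : (0 <= nnorm c f + nnorm c g)%E by rewrite adde_ge0 // nnorm_ge0.
split=> [|r]; first by rewrite adde_ge0.
case/lte_adde_split=> // s [t [fgs e't <-]].
have [a1 [b1 [a1' [b1' [XZ ZX ab1]]]]] := transports_both_cospan fgs.
have [a2 [b2 [a2' [b2' [ZY YZ ab2]]]]] := IH _ e't.
exists (a1%:num + a2%:num)%:nng, (b1%:num + b2%:num)%:nng,
  (a2'%:num + a1'%:num)%:nng, (b2'%:num + b1'%:num)%:nng; split.
- exact: transports_comp XZ ZY.
- exact: transports_comp YZ ZX.
- by rewrite /=; lra.
Qed.

End Transport.

(** * Lower bound for powers of free functors *)

Section FreePower.
Context (R : realType) (l : nat) (K : fieldType) (c : contour R l).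
Implicit Types (v w : ept R l) (X Y : pfun R l K).

Lemma dim_ppow_free v n x :
  \dim {:ppow (pfree K v) n x} = (n * ele v (Some x))%N.
Proof.
elim: n => [|n IHn]; first by rewrite dimvf.
by rewrite mulSn -[X in (X + _)%N]mul1n -IHn !dimvf.
Qed.

Lemma mul_pid_mx_inj (b b' : bool) : (b -> b') ->
  injective (mulmxr (pid_mx 1) : 'rV[K]_b -> 'rV[K]_b').
Proof.
case: b => [/(_ isT) ->|_] u w; last by move=> _; apply/rowP => -[].
by rewrite /= pid_mx_1 !mulmx1.
Qed.

Lemma pmap_free_inj v (x y : pt R l) (h : (x <= y)%O) :
  injective (pmap (pfree K v) h).
Proof.
by move=> u w; rewrite !lfunE; apply/mul_pid_mx_inj/ele_trans_pt.
Qed.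

Lemma pmap_ppow_inj X n (x y : pt R l) (h : (x <= y)%O) :
  injective (pmap X h) -> injective (pmap (ppow X n) h).
Proof.
move=> Xinj; elim: n => [|n IHn] //=; first by move=> u w; rewrite !lfunE.
move=> [u1 u2] [w1 w2]; rewrite !lfunE /= /sum_fun /=.
by case=> /Xinj -> /IHn ->.
Qed.

(** Nothing nonzero at [v] ever dies in the source, so the transport out of [v] is injective.
    Comparing dimensions at its endpoint [y] gives [w <= y] and [n <= m], unless acting on [v] by
    [b + a] already gives infinity. *)
Lemma step_transports v w n m (a b : {nonneg R}) : (0 < n)%N ->
  transports c (ppow (pfree K v) n) (ppow (pfree K w) m) a b ->
  (step c v (if (n <= m)%N then w else None) <= (a%:num + b%:num)%:E)%E.
Proof.
move=> n0 tr; set w' := if _ then _ else _.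
apply: (@step_le _ _ _ _ _ (a%:num + b%:num)%:nng).
(* Disposes of all cases in which the point reached is infinite. *)
have top u : ele None u -> ele w' u by case: u => //; case: w'.
case: v tr => [v|] tr; last exact/top/contour_ge.
have ba : b%:num + a%:num <= (a%:num + b%:num)%:nng%:num by rewrite /= addrC.
have := cact_add_le c (Some v) ba.
case Ev : (c (Some v) b) => [v1|]; last first.
  by move=> /(ele_trans (contour_ge c None a))/top.
have [y [hvy [phi [yv1 phiP]]]] := tr _ _ Ev.
move=> /(ele_trans (contour_mono c (v := Some y) (w := Some v1) yv1 (lexx a))).
case Ey : (c (Some y) a) => [q|]; last by move/top.
have hyq := cact_SomeW Ey.
apply: ele_trans; have: lker phi == 0%VS.
  apply/eqP/vspaceP => u; rewrite memv_ker memv0.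
  apply/eqP/eqP => [u0|->]; last by rewrite linear0.
  have hvq := le_trans hvy hyq.
  apply: (@pmap_ppow_inj (pfree K (Some v)) n _ _ hvq).
    exact: pmap_free_inj.
  by rewrite linear0 (phiP u y q (lexx y)) // u0 linear0.
move=> /eqP phi0; have /limg_dim_eq : (fullv :&: lker phi = 0)%VS.
  by rewrite phi0 capv0.
(* The inequality is [n <= m * [w <= y]]; as [n > 0], its right side cannot vanish. *)
move=> dimE; have := dimvS (subvf (limg phi)); rewrite dimE !dim_ppow_free /= lexx.
rewrite muln1 {top}/w'; case: (w) => [w1|] /=; last by rewrite muln0 leqNgt n0.
case: (boolP (w1 <= y)%O) => [w1y|_]; last by rewrite muln0 leqNgt n0.
by rewrite muln1 => ->; apply: le_trans hyq.
Qed.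

End FreePower.

(** * Norms of injective maps *)

Section Nat.
Context (R : realType) (l : nat) (K : fieldType) (c : contour R l).
Implicit Types (X Y A B : pfun R l K).

(** The kernel is zero and has norm 0; elements pushed into the image vanish in the cokernel. *)
Lemma nnorm_inj_le X Y (f : pnat X Y) (t : {nonneg R}) :
  (forall x, injective (f x)) ->
  (forall (x y : pt R l) (h : (x <= y)%O), c (Some x) t = Some y ->
    forall u, pmap Y h u \in limg (f y)) ->
  (nnorm c f <= t%:num%:E)%E.
Proof.
move=> finj fY; rewrite -[leRHS]add0e; apply: leeD.
  apply: (@pnorm_le _ _ _ _ _ 0%:nng) => x y h _; apply/lfunP => u.
  suff -> : pmap (pker f) h u = 0 by rewrite lfunE.
  apply/val_inj/(finj y); rewrite [RHS]linear0.
  by apply/eqP; rewrite -memv_ker subvsP.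
apply: pnorm_le => x y h xy; apply/lfunP => u.
suff -> : pmap (pcoker f) h u = 0 by rewrite lfunE.
rewrite -[u]coker_proj_val [LHS](coker_map_proj f h); apply/eqP.
by rewrite -memv_ker lker_coker_proj fY.
Qed.

Definition pnat_id X : pnat X X.
Proof. by exists (fun=> \1%VF) => x y h; rewrite comp_lfun1l comp_lfun1r. Defined.

Lemma nnorm_id X : (nnorm c (pnat_id X) <= 0)%E.
Proof.
apply: (@nnorm_inj_le _ _ _ 0%:nng) => [x u w|x y h _ u]; first by rewrite !lfunE.
by rewrite /= lim1g memvf.
Qed.

(** * Tameness of powers of free functors *)

Definition pnat_zero X Y : pnat X Y.
Proof. by exists (fun=> 0) => x y h; rewrite comp_lfun0l comp_lfun0r. Defined.

Lemma tame_zero X : (forall x (u : X x), u = 0) -> tame X.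
Proof.
move=> X0; pose Z := free_sum K ([::] : seq (pt R l)).
exists [::], [::], (pnat_zero Z Z), (pnat_zero _ _), (pnat_zero _ _) => x.
split; apply/lfunP => u; rewrite comp_lfunE !lfunE; first exact/esym/X0.
by apply: val_inj; rewrite [LHS]thinmx0 [RHS]thinmx0.
Qed.

(** A presentation without relations. The cokernel is realized on a complement of the zero subspace,
    hence only isomorphic to the sum, by projection and inclusion. *)
Lemma tame_free_sum (s : seq (pt R l)) : tame (free_sum K s).
Proof.
pose Y := free_sum K s; pose g := pnat_zero (free_sum K [::]) Y.
have projK x (u : Y x) : vsval (coker_proj g x u) = u.
  have /memv_imgP[w _] := coker_proj_decomp g (u : Y x).
  by rewrite [g x w]zero_lfunE => /eqP; rewrite subr_eq0 => /eqP <-.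
have proj_nat x y (h : (x <= y)%O) :
    (pmap (pcoker g) h \o coker_proj g x = coker_proj g y \o pmap Y h)%VF.
  by apply/lfunP => u; rewrite comp_lfunE [RHS]comp_lfunE; apply: coker_map_proj.
pose incl x : 'Hom(pcoker g x, Y x) := linfun (@vsval K (Y x) (limg (g x))^C).
have incl_nat x y (h : (x <= y)%O) :
    (pmap Y h \o incl x = incl y \o pmap (pcoker g) h)%VF.
  apply/lfunP => u; rewrite comp_lfunE [RHS]comp_lfunE !(lfunE (@vsval _ _ _)).
  by rewrite -[u]coker_proj_val [in RHS](coker_map_proj g h) /= !projK.
exists [::], s, g, (PNat proj_nat), (PNat incl_nat) => x.
split; apply/lfunP => u; rewrite comp_lfunE [RHS]lfunE.
  by rewrite [LHS]lfunE; apply: projK.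
by rewrite [pnat_app _ x u]lfunE; apply: coker_proj_val.
Qed.

Lemma tame_ppow_free (v : ept R l) n : tame (ppow (pfree K v) n).
Proof.
case: v => [a|].
  by have := tame_free_sum (nseq n a); rewrite /free_sum map_nseq.
(* At infinity the free functor is zero. *)
apply: tame_zero => x u; apply/eqP; rewrite -memv0.
suff -> : (0 = fullv :> {vspace ppow (pfree K None) n x})%VS by rewrite memvf.
by apply/esym/eqP; rewrite -dimv_eq0 dim_ppow_free muln0.
Qed.

(** * Maps between direct powers *)

Section Product.
Context (U U' V V' : vectType K) (f : 'Hom(U, U')) (g : 'Hom(V, V')).

Definition prod_fun (u : (U * V)%type) : (U' * V')%type := (f u.1, g u.2).

Lemma prod_fun_linear : linear prod_fun.
Proof. by move=> a u w; rewrite /prod_fun /= !linearP. Qed.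

HB.instance Definition _ :=
  GRing.isLinear.Build K (U * V)%type (U' * V')%type _ prod_fun prod_fun_linear.

Definition prod_lfun : 'Hom((U * V)%type, (U' * V')%type) := linfun prod_fun.

End Product.

Section Power.
Context (A B : pfun R l K) (f : pnat A B).

(** Applies [f] on the first [min(m, n)] summands; surplus source summands are killed and surplus
    target summands receive zero. *)
Fixpoint ppow_app m n x : 'Hom(ppow A m x, ppow B n x) :=
  match m, n return 'Hom(ppow A m x, ppow B n x) with
  | m'.+1, n'.+1 => prod_lfun (f x) (ppow_app m' n' x)
  | _, _ => 0
  end.

Lemma ppow_app_natural m n x y (h : (x <= y)%O) :
  (pmap (ppow B n) h \o ppow_app m n x = ppow_app m n y \o pmap (ppow A m) h)%VF.
Proof.
elim: m n => [|m IHm] [|n] /=; rewrite ?comp_lfun0l ?comp_lfun0r //.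
apply/lfunP => -[u1 u2]; rewrite !comp_lfunE !lfunE /= /prod_fun /sum_fun /=.
have /lfunP/(_ u1) := pnat_natural f h; have /lfunP/(_ u2) := IHm n.
by rewrite !comp_lfunE => -> ->.
Qed.

Definition ppow_nat m n : pnat (ppow A m) (ppow B n) :=
  PNat (ppow_app_natural m n).

Lemma ppow_app_inj m n x : (m <= n)%N -> injective (f x) ->
  injective (ppow_app m n x).
Proof.
move=> + finj; elim: m n => [|m IHm] [|n] //= mn.
- by move=> u w _; rewrite [u]thinmx0 [w]thinmx0.
- by move=> u w _; rewrite [u]thinmx0 [w]thinmx0.
move=> [u1 u2] [w1 w2]; rewrite !lfunE /= /prod_fun /=.
by case=> /finj -> /(IHm _ mn) ->.
Qed.

Lemma ppow_app_surj n x : limg (f x) = fullv -> limg (ppow_app n n x) = fullv.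
Proof.
move=> fsurj; apply/vspaceP => u; rewrite memvf; elim: n u => [|n IHn] /= u.
  by rewrite [u]thinmx0 mem0v.
case: u => u1 u2; have /memv_imgP[w1 _ u1E] : u1 \in limg (f x).
  by rewrite fsurj memvf.
have /memv_imgP[w2 _ u2E] := IHn u2.
apply/memv_imgP; exists (w1, w2); first exact: memvf.
by rewrite lfunE /= /prod_fun -u1E -u2E.
Qed.

End Power.

(** * Inclusions of free functors *)

Section FreeInclusion.
Context (v z : ept R l) (vz : ele v z).

Definition free_incl_app x : 'Hom(pfree K z x, pfree K v x) :=
  linfun (mulmxr (pid_mx 1 : 'M[K]_(ele z (Some x), ele v (Some x)))).

(** Only a middle dimension 0 could spoil the product, and then the source has dimension 0 too. *)
Lemma mul_pid_mx_bool (a b d : bool) : (a -> b) ->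
  (pid_mx 1 : 'M[K]_(a, b)) *m (pid_mx 1 : 'M[K]_(b, d)) = pid_mx 1.
Proof.
case: b => [_|]; first by rewrite pid_mx_id.
by case: a => [/(_ isT)|_] //; apply/matrixP => -[].
Qed.

Lemma free_incl_natural x y (h : (x <= y)%O) :
  (pmap (pfree K v) h \o free_incl_app x =
   free_incl_app y \o pmap (pfree K z) h)%VF.
Proof.
apply/lfunP => u; rewrite !comp_lfunE !lfunE /= /mulmxr -!mulmxA.
rewrite !mul_pid_mx_bool //; first exact: ele_trans_pt.
exact: ele_trans.
Qed.

Definition free_incl : pnat (pfree K z) (pfree K v) := PNat free_incl_natural.

Lemma free_incl_inj x : injective (free_incl x).
Proof. by move=> u w; rewrite !lfunE; apply/mul_pid_mx_inj/ele_trans. Qed.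

(** An injective map from dimension 1 to dimension at most 1. *)
Lemma free_incl_surj x : ele z (Some x) -> limg (free_incl x) = fullv.
Proof.
move=> zx; apply/eqP; rewrite eqEdim subvf limg_dim_eq.
  by rewrite !dimvf /= /dim /= zx leq_mul2l leq_b1 orbT.
by have /lker0P/eqP -> := @free_incl_inj x; rewrite capv0.
Qed.

End FreeInclusion.

End Nat.

(** * The two bounds on the distance *)

Section Distance.
Context (R : realType) (l : nat) (K : fieldType) (c : contour R l).

Definition ejoin (v w : ept R l) : ept R l :=
  match v, w with Some x, Some y => Some (x `|` y)%O | _, _ => None end.

Lemma ele_joinl (v w : ept R l) : ele v (ejoin v w).
Proof. by case: v w => [x|] [y|] //=; apply: leUl. Qed.

Lemma ele_joinr (v w : ept R l) : ele w (ejoin v w).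
Proof. by case: v w => [x|] [y|] //=; apply: leUr. Qed.

Lemma ele_join (v w u : ept R l) : ele v u -> ele w u -> ele (ejoin v w) u.
Proof. by case: v w u => [x|] [y|] [z|] //= xz yz; rewrite leUx xz. Qed.

(** If [v <= x] and [x] is moved to [y] by [t], then [y] is above [w] as well as [v], hence above
    [z], where the inclusion is onto. *)
Lemma nnorm_ppow_le (v w z : ept R l) (vz : ele v z) n m : (m <= n)%N ->
  (forall u, ele v u -> ele w u -> ele z u) ->
  (nnorm c (ppow_nat (free_incl K vz) m n) <=
   step c v (if n == m then w else None))%E.
Proof.
move=> mn zP; apply: le_ereal_inf_tmp => _ [t wt ->].
apply: nnorm_inj_le => [x|x y h xy u].
  exact/(ppow_app_inj mn)/free_incl_inj.
have [vx|nvx] := boolP (ele v (Some x)); last first.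
  suff -> : u = 0 by rewrite linear0 mem0v.
  apply/eqP; rewrite -memv0.
  suff -> : (0 = fullv :> {vspace ppow (pfree K v) n x})%VS by rewrite memvf.
  by apply/esym/eqP; rewrite -dimv_eq0 dim_ppow_free (negbTE nvx) muln0.
have vty := contour_mono c vx (lexx t); rewrite xy in vty.
(* For [n <> m] the target is infinity, which is not below the finite point [y]. *)
have := ele_trans wt vty; case: eqP => // nm wy.
rewrite /= -nm (ppow_app_surj n (free_incl_surj _ vz _)) ?memvf //.
by apply: zP => //; apply: ele_trans_pt h vx.
Qed.

Lemma pdist_ppow_le (v w : ept R l) n m : (m <= n)%N ->
  (pdist c (ppow (pfree K v) n) (ppow (pfree K w) m) <=
   step c v (if n == m then w else None) + step c w v)%E.
Proof.
move=> mn; set X := ppow _ n; set Y := ppow _ m.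
have [vz wz] := (ele_joinl v w, ele_joinr v w).
pose f := ppow_nat (free_incl K vz) m n.
pose g := ppow_nat (free_incl K wz) m m.
(* With [Z] the [m]-th power of the free functor at the join, the zig-zag is [X = X <- Z -> Y = Y];
   identities fit it to the alternating pattern. *)
apply: ge_ereal_inf; exists
  (nnorm c (pnat_id X) + nnorm c f + (nnorm c g + nnorm c (pnat_id Y)))%E.
  have tameZ := tame_ppow_free K (ejoin v w) m.
  by apply: ZigzagCons; try apply: tame_ppow_free;
    apply: ZigzagOne; try apply: tame_ppow_free.
apply: leeD.
  rewrite -[leRHS]add0e leeD ?nnorm_id ?nnorm_ppow_le // => u.
  exact: ele_join.
rewrite -[leRHS]adde0 leeD ?nnorm_id //.
have := @nnorm_ppow_le w v _ wz m m (leqnn m); rewrite eqxx; apply => u wu vu.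
exact: ele_join.
Qed.

Lemma pdist_ppow_ge (v w : ept R l) n m : (0 < m)%N -> (m <= n)%N ->
  (step c v (if n == m then w else None) + step c w v <=
   pdist c (ppow (pfree K v) n) (ppow (pfree K w) m))%E.
Proof.
move=> m0 mn; apply: le_ereal_inf_tmp => e /zigzag_transports[e0 tr].
case: e => [e||] // in e0 tr *; last by rewrite leey.
(* The transports need a bound strictly above [e], hence an arbitrary slack [d]. *)
apply/lee_addgt0Pr => d d0.
have [|a [b [a' [b' [fwd bwd abs]]]]] := tr (e + d); first by rewrite lte_fin ltrDl.
apply: (@le_trans _ _
  ((a%:num + b%:num)%:E + (a'%:num + b'%:num)%:E)%E); last first.
  by rewrite -!EFinD lee_fin.
apply: leeD.
  (* Given [m <= n], the test [n <= m] agrees with [n == m]; in the reverse direction the test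
     [m <= n] always succeeds. *)
  by have := step_transports (leq_trans m0 mn) fwd; rewrite eqn_leq mn andbT.
by have := step_transports m0 bwd; rewrite mn.
Qed.

End Distance.

Theorem proposition8p1 (R : realType) (l : nat) (K : fieldType)
    (c : contour R l) (v w : ept R l) (n m : nat)
    (m_gt0 : (0 < m)%N) (le_mn : (m <= n)%N) :
  pdist c (ppow (pfree K v) n) (ppow (pfree K w) m) =
  if n == m then (step c v w + step c w v)%E
  else (step c v eptoo + step c w v)%E.
Proof.
transitivity (step c v (if n == m then w else None) + step c w v)%E.
  by apply/le_anti; rewrite pdist_ppow_le // pdist_ppow_ge.
by case: eqP.
Qed.
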